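(* Let $\Bbbk=\mathbb{Q}$ and let $\chi^\circ:(H^\circ,\mu,\Delta,\delta)\to(\mathbb{Q}[x],\mu,\Delta,\delta)$ be the unique double bialgebra morphism. Then for every finite hypergraph $(E,V)$ without empty edges, $\chi^\circ$ maps $(E,V)$ to its chromatic polynomial $\chi_{E,V}(x)$, i.e. to the polynomial whose value at each integer $n\ge 0$ is the number of colorings of $(E,V)$ with $n$ colors.
   Context: A hypergraph $(E,V)$ is a map of sets $h:E\to P(V)$, with $P(V)$ the power set of $V$; elements of $E$ are edges, elements of $V$ are vertices, and an edge $e$ is identified with its vertex set $h(e)\subseteq V$. Distinct edges may have the same vertex set. $H^\circ$ is the $\mathbb{Q}$-vector space with basis the isomorphism classes of hypergraphs with $E,V$ finite and with no edge having empty vertex set. Product $\mu$ on $H^\circ$: disjoint union, with unit $(\emptyset,\emptyset)$. Coproduct $\Delta(E,V)=\sum_{U\subseteq V}(E_{|U},U)\otimes(E_{|U^c},U^c)$, where $E_{|U}=\{e\in E:h(e)\subseteq U\}$ and $U^c=V\setminus U$; its counit sends $(E,V)$ to $1$ if $V=\emptyset$ and to $0$ otherwise. Coproduct $\delta(E,V)=\sum_{F\subseteq E}(F,V)\otimes(F^c,V/F)$, where $F^c=E\setminus F$, $V/F$ is the quotient of $V$ by the equivalence relation generated by $u\sim u'$ if $u,u'$ lie on a common edge of $F$, and $(F^c,V/F)$ is given by $F^c\subseteq E\to P(V)\to P(V/F)$ (direct image under the quotient map); its counit sends $(E,V)$ to $1$ if $E=\emptyset$ and to $0$ otherwise. Double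 bialgebra: $(B,\mu,\Delta,\delta)$ such that $(B,\mu,\Delta)$ and $(B,\mu,\delta)$ are bialgebras (same product and unit, each coproduct with its own counit $\epsilon_\Delta$, $\epsilon_\delta$) and $(\mathrm{id}\otimes\epsilon_\Delta)\circ\delta=\eta\circ\epsilon_\Delta$ and $(\mathrm{id}\otimes\Delta)\circ\delta=m_{13,2,4}\circ(\delta\otimes\delta)\circ\Delta$, where $m_{13,2,4}(a\otimes b\otimes c\otimes d)=ac\otimes b\otimes d$. $(H^\circ,\mu,\Delta,\delta)$ is a double bialgebra. A double bialgebra morphism is a linear map which is a bialgebra morphism (respecting product, unit, coproduct, counit) both for the $\Delta$-structures and for the $\delta$-structures. On the polynomial ring $\mathbb{Q}[x]$: $\mu$ is the usual product, $\Delta$ and $\delta$ are the algebra morphisms with $\Delta(x)=x\otimes1+1\otimes x$ and $\delta(x)=x\otimes x$, with counits $x\mapsto 0$ and $x\mapsto 1$ respectively. By a known theorem of Foissy there is exactly one double bialgebra morphism $\chi^\circ:H^\circ\to\mathbb{Q}[x]$. A coloring of $(E,V)$ by a set $C$ (of colors) is a map $V\to C$ such that no edge is monochromatic, i.e. for each edge not all of its vertices have the same color. (In particular an edge with exactly one vertex prevents any coloring; if $V=\emptyset$ there is exactly one coloring for every $C$.) The number of colorings with $n$ colors is a polynomial in $n$. *)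

(* Defs.v *)
From HB Require Import structures.
From mathcomp Require Import all_boot all_order all_algebra.
From mathcomp Require Import finmap.
From mathcomp.classical Require Import boolp.
From mathcomp.multinomials Require Import monalg.

Set Implicit Arguments.
Unset Strict Implicit.
Unset Printing Implicit Defensive.

Import GRing.Theory.

Local Open Scope quotient_scope.
Local Open Scope ring_scope.

(* Finite hypergraphs without empty edges; distinct edges may be incident to
   the same set of vertices. *)
Record hypergraph := Hypergraph {
  edge : finType;
  vertex : finType;
  inc : edge -> {set vertex};
  inc_neq0 : forall e, inc e != set0 }.

Definition is_hg_iso (G H : hypergraph)
    (f : edge G -> edge H) (g : vertex G -> vertex H) : Prop :=
  [/\ bijective f, bijective g & forall e, inc (f e) = g @: inc e].

Definition hg_iso (G H : hypergraph) : bool :=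
  `[< exists f g, @is_hg_iso G H f g >].

Lemma hg_isoP G H : reflect (exists f g, @is_hg_iso G H f g) (hg_iso G H).
Proof. exact: asboolP. Qed.

Lemma hg_iso_refl : reflexive hg_iso.
Proof.
move=> G; apply/hg_isoP; exists id, id; split; try by exists id.
by move=> e; rewrite imset_id.
Qed.

Lemma hg_iso_symW G H : hg_iso G H -> hg_iso H G.
Proof.
move=> /hg_isoP[f [g [[f' fK f'K] [g' gK g'K] fg]]]; apply/hg_isoP.
exists f', g'; split; [by exists f|by exists g|move=> e].
rewrite -[in RHS](f'K e) fg -imset_comp -[LHS]imset_id.
by apply: eq_imset => x /=; rewrite gK.
Qed.

Lemma hg_iso_sym : symmetric hg_iso.
Proof. by move=> G H; apply/idP/idP; apply: hg_iso_symW. Qed.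

Lemma hg_iso_trans : transitive hg_iso.
Proof.
move=> H G K /hg_isoP[f [g [fb gb fg]]] /hg_isoP[f' [g' [fb' gb' fg']]].
apply/hg_isoP; exists (f' \o f), (g' \o g).
split; [exact: bij_comp|exact: bij_comp|move=> e /=].
by rewrite fg' fg -imset_comp.
Qed.

Canonical hg_iso_equiv := EquivRel hg_iso hg_iso_refl hg_iso_sym hg_iso_trans.

(* Hypergraphs on ordinals form a choiceType meeting every isomorphism class;
   they are what the quotient hclass of hypergraph below is built from. *)
Definition ord_inc_type := {p : nat * nat & {ffun 'I_p.1 -> {set 'I_p.2}}}.

Definition ord_noempty (G : ord_inc_type) := [forall e, tagged G e != set0].

Definition ord_hypergraph := {G : ord_inc_type | ord_noempty G}.

Definition of_ord (G : ord_hypergraph) : hypergraph :=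
  Hypergraph (elimT forallP (valP G)).

Definition ord_inc (G : hypergraph) : ord_inc_type :=
  existT _ (#|edge G|, #|vertex G|)
    [ffun e => enum_rank @: inc (enum_val e : edge G)].

Lemma ord_inc_neq0 (G : hypergraph) :
  ord_noempty (ord_inc G).
Proof. by apply/forallP => e; rewrite ffunE imset_eq0 inc_neq0. Qed.

Definition to_ord (G : hypergraph) : ord_hypergraph := 
  exist (fun G => is_true (ord_noempty G)) _ (ord_inc_neq0 G).

Lemma to_ordK (G : hypergraph) : hg_iso (of_ord (to_ord G)) G.
Proof.
apply: hg_iso_symW; apply/hg_isoP; exists enum_rank, enum_rank; split.
- by exists enum_val; [exact: enum_rankK|exact: enum_valK].
- by exists enum_val; [exact: enum_rankK|exact: enum_valK].
- by move=> e /=; rewrite ffunE enum_rankK.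
Qed.

Canonical hg_iso_encModRel := EncModRel hg_iso to_ordK.

Definition hclass : Type := {eq_quot hg_iso_encModRel}.
HB.instance Definition _ := Choice.on hclass.
HB.instance Definition _ := EqQuotient.on hclass.

Definition class (G : hypergraph) : hclass := \pi_hclass G.

Lemma classP G H : (class G = class H) <-> hg_iso G H.
Proof. by split=> [/eqquotP|h]; [|apply/eqquotP]. Qed.

Lemma class_repr (c : hclass) : class (repr c) = c.
Proof. exact: reprK. Qed.

Lemma repr_class (G : hypergraph) : hg_iso (repr (class G)) G.
Proof. by apply/classP; rewrite class_repr. Qed.

Definition hdisj_inc (G H : hypergraph) (e : edge G + edge H) :
    {set vertex G + vertex H} :=
  match e with inl e => inl @: inc e | inr e => inr @: inc e end.

Lemma hdisj_inc_neq0 G H (e : edge G + edge H) : hdisj_inc e != set0.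
Proof. by case: e => e; rewrite imset_eq0 inc_neq0. Qed.

Definition hdisj (G H : hypergraph) : hypergraph :=
  Hypergraph (@hdisj_inc_neq0 G H).

Definition hempty : hypergraph :=
  @Hypergraph void void (fun e => match e with end) (fun e => match e with end).

Definition hmul (c d : hclass) : hclass := class (hdisj (repr c) (repr d)).

Lemma hdisj_iso G G' H H' :
  hg_iso G G' -> hg_iso H H' -> hg_iso (hdisj G H) (hdisj G' H').
Proof.
have sum_bij (A A' B B' : Type) (f : A -> A') (g : B -> B') :
    bijective f -> bijective g ->
    bijective (fun x : A + B => match x with inl a => inl (f a)
                                       | inr b => inr (g b) end).
  move=> [f' fK f'K] [g' gK g'K].
  exists (fun x : A' + B' => match x with inl a => inl (f' a)
                                       | inr b => inr (g' b) end).
    by case=> x; rewrite ?fK ?gK.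
  by case=> x; rewrite ?f'K ?g'K.
move=> /hg_isoP[f [g [fb gb fg]]] /hg_isoP[f' [g' [fb' gb' fg']]].
apply/hg_isoP; do 2 eexists; split; [exact: (sum_bij _ _ _ _ f f')|
  exact: (sum_bij _ _ _ _ g g')|].
by case=> e /=; rewrite ?fg ?fg' -!imset_comp.
Qed.

Lemma hmul_class G H : hmul (class G) (class H) = class (hdisj G H).
Proof. by apply/classP/hdisj_iso; apply: repr_class. Qed.

Lemma hmulC : commutative hmul.
Proof.
move=> c d; apply/classP/hg_isoP.
exists (fun x => match x with inl a => inr a | inr b => inl b end).
exists (fun x => match x with inl a => inr a | inr b => inl b end).
split; try by exists (fun x => match x with inl a => inr a | inr b => inl b end); case.
by case=> e /=; rewrite -imset_comp.
Qed.

Lemma hmulA : associative hmul.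
Proof.
move=> c d k; rewrite -(class_repr c) -(class_repr d) -(class_repr k).
rewrite !hmul_class; apply/classP/hg_isoP.
pose l (A B C : Type) (x : A + (B + C)) : (A + B) + C :=
  match x with inl a => inl (inl a) | inr (inl b) => inl (inr b)
             | inr (inr c) => inr c end.
have lb A B C : bijective (@l A B C).
  exists (fun x => match x with inl (inl a) => inl a | inl (inr b) => inr (inl b)
             | inr c => inr (inr c) end); first by case=> [|[]].
  by case=> [[]|].
exists (@l _ _ _), (@l _ _ _); split; [exact: lb|exact: lb|].
by case=> [e|[e|e]] /=; rewrite -!imset_comp.
Qed.

Lemma hmul1c : left_id (class hempty) hmul.
Proof.
move=> c; rewrite -{1}(class_repr c) hmul_class -[RHS]class_repr.
have inrb (A : Type) : bijective (@inr void A).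
  exists (fun x : void + A =>
    match x with inl v => match v : void with end | inr e => e end) => //.
  by case=> [[]|].
apply/classP/hg_iso_symW/hg_isoP; exists inr, inr.
by split; [exact: inrb|exact: inrb|].
Qed.

Lemma hmulc1 : right_id (class hempty) hmul.
Proof. by move=> c; rewrite hmulC hmul1c. Qed.

Lemma hempty_iso G : #|edge G| = 0%N -> #|vertex G| = 0%N -> hg_iso G hempty.
Proof.
move=> e0 v0; apply: hg_iso_symW; apply/hg_isoP.
exists (fun e : void => match e with end), (fun e : void => match e with end).
split; last by case.
- by apply: inj_card_bij; [case|rewrite /= e0].
- by apply: inj_card_bij; [case|rewrite /= v0].
Qed.

Lemma hmul_eq1 c d :
  hmul c d = class hempty -> c = class hempty /\ d = class hempty.
Proof.
move=> /classP/hg_isoP[f [g [fb gb _]]].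
have /= := bij_eq_card fb; rewrite card_sum card_void => /eqP.
rewrite addn_eq0 => /andP[/eqP e1 /eqP e2].
have /= := bij_eq_card gb; rewrite card_sum card_void => /eqP.
rewrite addn_eq0 => /andP[/eqP v1 /eqP v2].
by split; [rewrite -(class_repr c)|rewrite -(class_repr d)];
  apply/classP/hempty_iso.
Qed.

(* With this structure, {malg rat[hclass]} becomes a commutative algebra whose
   product extends disjoint union bilinearly. *)
HB.instance Definition _ := Choice_isMonomialDef.Build hclass
  hmulA hmul1c hmulc1 hmul_eq1.
HB.instance Definition _ := MonomialDef_isConomialDef.Build hclass hmulC.

Notation Hcirc := {malg rat[hclass]}.

(* A tensor square of a space with basis K has basis K * K: << (c, d) >>
   stands for << c >> (x) << d >>. *)
Notation Hcirc2 := {malg rat[(hclass * hclass)%type]}.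

(* Linear extension of a map defined on a basis. *)
Definition linext (K : choiceType) (M : lmodType rat) (f : K -> M)
    (a : {malg rat[K]}) : M :=
  \sum_(k <- msupp a) a@_k *: f k.

Lemma linextU (K : choiceType) (M : lmodType rat) (f : K -> M) (k : K) :
  linext f << k >> = f k.
Proof. by rewrite /linext msuppU oner_eq0 big_seq_fset1 mcoeffUU scale1r. Qed.

Lemma linext_is_linear (K : choiceType) (M : lmodType rat) (f : K -> M) :
  linear (linext f).
Proof.
have linextw (d : {fset K}) (a : {malg rat[K]}) : (msupp a `<=` d)%fset ->
    linext f a = \sum_(k <- d) a@_k *: f k.
  move=> le; rewrite /linext (big_fset_incl _ le) => //= k _.
  by move=> /mcoeff_outdom ->; rewrite scale0r.
move=> x a b; pose d := (msupp a `|` msupp b)%fset.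
have ad : (msupp a `<=` d)%fset by exact: fsubsetUl.
have bd : (msupp b `<=` d)%fset by exact: fsubsetUr.
have cd : (msupp (x *: a + b) `<=` d)%fset.
  apply: fsubset_trans (msuppD_le _ _) _; rewrite fsubUset bd andbT.
  exact: fsubset_trans (msuppZ_le _ _) ad.
rewrite (linextw d _ cd) (linextw d _ ad) (linextw d _ bd) scaler_sumr.
rewrite -big_split; apply: eq_bigr => k _ /=.
by rewrite mcoeffD mcoeffZ scalerDl scalerA.
Qed.

HB.instance Definition _ (K : choiceType) (M : lmodType rat) (f : K -> M) :=
  GRing.isLinear.Build rat {malg rat[K]} M *:%R (linext f)
    (linext_is_linear f).

(* (E_{|U}, U) *)
Section Restriction.
Variables (G : hypergraph) (U : {set vertex G}).

Definition hrestr_inc (e : {e : edge G | inc e \subset U}) :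
    {set {v : vertex G | v \in U}} :=
  [set v | val v \in inc (val e)].

Lemma hrestr_inc_neq0 e : hrestr_inc e != set0.
Proof.
case: e => e eU; have /set0Pn[v ve] := inc_neq0 e.
apply/set0Pn; exists (exist _ v (subsetP eU v ve)).
by rewrite inE.
Qed.

Definition hrestr : hypergraph := Hypergraph hrestr_inc_neq0.

End Restriction.

Section EdgeSubset.
Variables (G : hypergraph) (F : {set edge G}).

(* (F, V) *)
Definition hedges : hypergraph :=
  @Hypergraph {e : edge G | e \in F} (vertex G) (fun e => inc (val e))
    (fun e => inc_neq0 (val e)).

(* connect yields the generated equivalence relation, the relation below being
   symmetric. *)
Definition hlinked : rel (vertex G) :=
  [rel u v | [exists e in F, (u \in inc e) && (v \in inc e)]].

Definition hblock (v : vertex G) : {set vertex G} :=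
  [set u | connect hlinked v u].

(* V/F, whose points are the equivalence classes *)
Definition hquot : finType :=
  {B : {set vertex G} | B \in [set hblock v | v in [set: vertex G]]}.

Definition hproj (v : vertex G) : hquot :=
  exist _ (hblock v) (imset_f hblock (in_setT v)).

(* (F^c, V/F) *)
Definition hcontr_inc (e : {e : edge G | e \in ~: F}) : {set hquot} :=
  hproj @: inc (val e).

Lemma hcontr_inc_neq0 e : hcontr_inc e != set0.
Proof. by rewrite imset_eq0 inc_neq0. Qed.

Definition hcontr : hypergraph := Hypergraph hcontr_inc_neq0.

End EdgeSubset.

Definition DeltaG (G : hypergraph) : Hcirc2 :=
  \sum_(U : {set vertex G}) << (class (hrestr U), class (hrestr (~: U))) >>.

Definition deltaG (G : hypergraph) : Hcirc2 :=
  \sum_(F : {set edge G}) << (class (hedges F), class (hcontr F)) >>.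

Definition epsDeltaG (G : hypergraph) : rat := (#|vertex G| == 0%N)%:R.

Definition epsdeltaG (G : hypergraph) : rat := (#|edge G| == 0%N)%:R.

Lemma bij_sig (A B : Type) (P : pred A) (Q : pred B) (f : A -> B) :
  bijective f -> (forall x, Q (f x) = P x) ->
  exists2 h : {x | P x} -> {y | Q y},
    bijective h & forall x, val (h x) = f (val x).
Proof.
move=> [f' fK f'K] PQ.
have QP y : P (f' y) = Q y by rewrite -PQ f'K.
have hP (x : {x | P x}) : Q (f (val x)) by rewrite PQ; exact: valP.
have hQ (y : {y | Q y}) : P (f' (val y)) by rewrite QP; exact: valP.
exists (fun x => exist (fun y => is_true (Q y)) (f (val x)) (hP x)) => //.
exists (fun y => exist (fun x => is_true (P x)) (f' (val y)) (hQ y)).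
  by move=> x; apply: val_inj; rewrite /= fK.
by move=> x; apply: val_inj; rewrite /= f'K.
Qed.

Lemma bij_imset (A B : finType) (f : A -> B) :
  bijective f -> bijective (fun X : {set A} => f @: X).
Proof.
move=> [f' fK f'K]; exists (fun X : {set B} => f' @: X) => X;
  rewrite -imset_comp -[RHS]imset_id; apply: eq_imset => x /=.
  exact: fK.
exact: f'K.
Qed.

Section IsoInvariance.
Variables (G H : hypergraph) (f : edge G -> edge H) (g : vertex G -> vertex H).
Hypothesis fg_iso : is_hg_iso f g.

Let fb : bijective f. Proof. by case: fg_iso. Qed.
Let gb : bijective g. Proof. by case: fg_iso. Qed.
Let incE e : inc (f e) = g @: inc e. Proof. by case: fg_iso. Qed.

Lemma hrestr_iso (U : {set vertex G}) : hg_iso (hrestr U) (hrestr (g @: U)).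
Proof.
have gi := bij_inj gb.
have [hV hVb hVE] : exists2 h : vertex (hrestr U) -> vertex (hrestr (g @: U)),
    bijective h & forall x, val (h x) = g (val x).
  by apply: bij_sig => // v; rewrite mem_imset.
have [hE hEb hEE] : exists2 h : edge (hrestr U) -> edge (hrestr (g @: U)),
    bijective h & forall x, val (h x) = f (val x).
  apply: bij_sig => // e; rewrite incE; apply/idP/idP; last exact: imsetS.
  by move=> /subsetP s; apply/subsetP => v ve; rewrite -(mem_imset _ _ gi) s ?imset_f.
apply/hg_isoP; exists hE, hV; split => // e; apply/setP => v.
have [hV' hVK hV'K] := hVb; rewrite -(hV'K v) mem_imset; last exact: bij_inj.
by rewrite !inE hEE incE hVE mem_imset.
Qed.

Lemma hedges_iso (F : {set edge G}) : hg_iso (hedges F) (hedges (f @: F)).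
Proof.
have [h hb hE] : exists2 h : edge (hedges F) -> edge (hedges (f @: F)),
    bijective h & forall x, val (h x) = f (val x).
  by apply: bij_sig => // e; rewrite mem_imset //; exact: bij_inj.
by apply/hg_isoP; exists h, g; split => // e; rewrite /= hE incE.
Qed.

Lemma hlinked_iso (F : {set edge G}) u v :
  hlinked (f @: F) (g u) (g v) = hlinked F u v.
Proof.
have gi := bij_inj gb.
apply/exists_inP/exists_inP => [[e' /imsetP[e eF ->]]|[e eF uv]].
  by rewrite incE !mem_imset // => uv; exists e.
by exists (f e); [exact: imset_f|rewrite incE !mem_imset].
Qed.

Lemma connect_iso (F : {set edge G}) u v :
  connect (hlinked (f @: F)) (g u) (g v) = connect (hlinked F) u v.
Proof.
have [g' gK g'K] := gb.
have homo (A B : finType) (r : rel A) (s : rel B) (k : A -> B) :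
    (forall x y, r x y -> s (k x) (k y)) ->
    forall x y, connect r x y -> connect s (k x) (k y).
  move=> rs x y /connectP[p]; elim: p x => [|z p IH] x /=.
    by move=> _ ->; exact: connect0.
  move=> /andP[xz zp] yE; apply: connect_trans (connect1 (rs _ _ xz)) _.
  exact: IH.
apply/idP/idP; last by apply: homo => x y; rewrite hlinked_iso.
move=> c; rewrite -(gK u) -(gK v); move: c; apply: homo => x y.
by rewrite -{1}(g'K x) -{1}(g'K y) hlinked_iso.
Qed.

Lemma hblock_iso (F : {set edge G}) v :
  hblock (f @: F) (g v) = g @: hblock F v.
Proof.
have gi := bij_inj gb; have [g' gK g'K] := gb.
by apply/setP => w; rewrite -(g'K w) mem_imset // !inE connect_iso.
Qed.

Lemma hcontr_iso (F : {set edge G}) : hg_iso (hcontr F) (hcontr (f @: F)).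
Proof.
have gi := bij_inj gb; have [g' gK g'K] := gb.
have [hE hEb hEE] : exists2 h : edge (hcontr F) -> edge (hcontr (f @: F)),
    bijective h & forall x, val (h x) = f (val x).
  by apply: bij_sig => // e; rewrite !inE mem_imset //; exact: bij_inj.
have [hV hVb hVE] : exists2 h : hquot F -> hquot (f @: F),
    bijective h & forall x, val (h x) = g @: val x.
  apply: (@bij_sig _ _ (fun B => B \in [set hblock F v | v in [set: vertex G]])
    (fun B => B \in [set hblock (f @: F) v | v in [set: vertex H]])
    (fun B : {set vertex G} => g @: B)); first exact: bij_imset.
  have giS : injective (fun X : {set vertex G} => g @: X).
    exact/bij_inj/bij_imset.
  move=> B; apply/imsetP/imsetP => [[w _ BE]|[v _ ->]].
    exists (g' w); rewrite ?inE //; apply: giS.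
    by rewrite /= BE -hblock_iso g'K.
  by exists (g v); rewrite ?inE // hblock_iso.
apply/hg_isoP; exists hE, hV; split => // e.
rewrite /= /hcontr_inc hEE incE -!imset_comp; apply: eq_imset => v /=.
by apply: val_inj; rewrite hVE /= hblock_iso.
Qed.

Lemma DeltaG_iso : DeltaG G = DeltaG H.
Proof.
rewrite /DeltaG [RHS](reindex (fun U : {set vertex G} => g @: U)) /=; last first.
  by have [h hK h'K] := bij_imset gb; exists h => X _; [exact: hK|exact: h'K].
apply: eq_bigr => U _.
have -> : ~: (g @: U) = g @: ~: U.
  have gi := bij_inj gb; have [g' gK g'K] := gb.
  by apply/setP => w; rewrite -(g'K w) !(inE, mem_imset).
by rewrite (iffRL (classP _ _) (hrestr_iso U))
           (iffRL (classP _ _) (hrestr_iso (~: U))).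
Qed.

Lemma deltaG_iso : deltaG G = deltaG H.
Proof.
rewrite /deltaG [RHS](reindex (fun F : {set edge G} => f @: F)) /=; last first.
  by have [h hK h'K] := bij_imset fb; exists h => X _; [exact: hK|exact: h'K].
apply: eq_bigr => F _.
by rewrite (iffRL (classP _ _) (hedges_iso F))
           (iffRL (classP _ _) (hcontr_iso F)).
Qed.

Lemma epsDeltaG_iso : epsDeltaG G = epsDeltaG H.
Proof. by rewrite /epsDeltaG (bij_eq_card gb). Qed.

Lemma epsdeltaG_iso : epsdeltaG G = epsdeltaG H.
Proof. by rewrite /epsdeltaG (bij_eq_card fb). Qed.

End IsoInvariance.

Definition Delta : Hcirc -> Hcirc2 := linext (fun c : hclass => DeltaG (repr c)).
Definition delta : Hcirc -> Hcirc2 := linext (fun c : hclass => deltaG (repr c)).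
Definition epsDelta : Hcirc -> rat :=
  mmap idfun (fun c : hclass => epsDeltaG (repr c)).
Definition epsdelta : Hcirc -> rat :=
  mmap idfun (fun c : hclass => epsdeltaG (repr c)).

(* The values on a class do not depend on the representative chosen. *)
Lemma Delta_class G : Delta << class G >> = DeltaG G.
Proof.
rewrite /Delta linextU.
by have /hg_isoP[f [g fg]] := repr_class G; exact: DeltaG_iso fg.
Qed.

Lemma delta_class G : delta << class G >> = deltaG G.
Proof.
rewrite /delta linextU.
by have /hg_isoP[f [g fg]] := repr_class G; exact: deltaG_iso fg.
Qed.

Lemma epsDelta_class G : epsDelta << class G >> = epsDeltaG G.
Proof.
rewrite /epsDelta mmapU mul1r.
by have /hg_isoP[f [g fg]] := repr_class G; exact: epsDeltaG_iso fg.
Qed.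

Lemma epsdelta_class G : epsdelta << class G >> = epsdeltaG G.
Proof.
rewrite /epsdelta mmapU mul1r.
by have /hg_isoP[f [g fg]] := repr_class G; exact: epsdeltaG_iso fg.
Qed.

(* Q[x] (x) Q[x] is {poly {poly rat}}: the variable 'X stands for x (x) 1 and
   'Y = 'X%:P for 1 (x) x, so the coproducts of Q[x] are polyXY's poly_XaY
   (substitution of 'X + 'Y) and poly_XmY (substitution of 'X * 'Y). *)
Definition ptensor (p q : {poly rat}) : {poly {poly rat}} := p^:P * q%:P.

(* f (x) f, i.e. << (c, d) >> |-> f << c >> (x) f << d >>, extended linearly *)
Definition tensor2 (f : Hcirc -> {poly rat}) : Hcirc2 -> {poly {poly rat}} :=
  mmap (polyC \o polyC)
    (fun c : hclass * hclass => ptensor (f << c.1 >>) (f << c.2 >>)).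

(* The morphism conditions other than linearity and compatibility with product
   and unit, which are part of {lrmorphism _ -> _}. *)
Record double_bialgebra_morphism (f : {lrmorphism Hcirc -> {poly rat}}) : Prop := {
  dbm_Delta : forall a, poly_XaY (f a) = tensor2 f (Delta a);
  dbm_epsDelta : forall a, (f a).[0] = epsDelta a;
  dbm_delta : forall a, poly_XmY (f a) = tensor2 f (delta a);
  dbm_epsdelta : forall a, (f a).[1] = epsdelta a }.

Definition colorings (G : hypergraph) (C : finType) : {set {ffun vertex G -> C}} :=
  [set c : {ffun vertex G -> C} |
    [forall e : edge G, ~~ [forall u in inc e, forall v in inc e, c u == c v]]].

(* Main.v *)
Require Import Defs.
From mathcomp Require Import all_boot all_order all_algebra.
From mathcomp.multinomials Require Import monalg.

(** Compatibility with [Delta] evaluated at [(n, 1)], together with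
    [chi(G)(1) = epsdelta(G)], gives
    [chi(G)(n + 1) = \sum_U chi(G|U)(n) * [no edge of G lies inside U^c]].
    The number of colorings satisfies the same recursion: [U^c] is the class of
    the last color, an edge meeting both [U] and [U^c] being automatically
    non-monochromatic.  At [n = 0] both sides equal [epsDelta(G)]. *)

Set Implicit Arguments.
Unset Strict Implicit.
Unset Printing Implicit Defensive.

Import GRing.Theory.

Local Open Scope ring_scope.

Lemma coloringsP (G : hypergraph) (C : finType) (c : {ffun vertex G -> C}) :
  reflect (forall e : edge G, exists u v,
             [/\ u \in inc e, v \in inc e & c u != c v])
          (c \in colorings G C).
Proof.
rewrite inE; apply: (iffP forallP) => nmono e.
  have /forall_inPn[u ue /forall_inPn[v ve uv]] := nmono e.
  by exists u, v.
have [u [v [ue ve uv]]] := nmono e.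
by apply/forall_inPn; exists u => //; apply/forall_inPn; exists v.
Qed.

(** Base case of the recursion. Edges are nonempty, so without vertices there are no edges and the
    empty map is a coloring. *)
Lemma card_colorings0 (G : hypergraph) :
  #|colorings G 'I_0| = (#|vertex G| == 0%N).
Proof.
have [V0|/card_gt0P[v _]] := posnP #|vertex G|; last first.
  by apply: eq_card0 => c; case: (c v).
have -> : colorings G 'I_0 = setT.
  apply/setP => c; rewrite in_setT; apply/coloringsP => e.
  have /set0Pn[v _] := inc_neq0 e.
  by have := fintype0 v V0.
by rewrite cardsT card_ffun card_ord V0.
Qed.

(** Applied to [~: U], this turns the value of the counit [epsdelta] into a condition on the edges
    of [G]. *)
Lemma card_edge_hrestr_eq0 (G : hypergraph) (U : {set vertex G}) :
  (#|edge (hrestr U)| == 0%N) = [forall e : edge G, ~~ (inc e \subset U)].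
Proof.
apply/eqP/forallP => [E0 e|noE].
  by apply/negP => eU; have := fintype0 (exist _ e eU : edge (hrestr U)) E0.
by apply: eq_card0 => -[e eU]; move: (noE e); rewrite eU.
Qed.

Section LastColor.
Variables (G : hypergraph) (n : nat).

Definition not_last (c : {ffun vertex G -> 'I_n.+1}) : {set vertex G} :=
  [set v | c v != ord_max].

Variable U : {set vertex G}.

(** [lift ord_max] embeds ['I_n] as the colors other than the last, so the last color appears
    exactly off [U]. *)
Definition extend_last (c : {ffun vertex (hrestr U) -> 'I_n}) :
    {ffun vertex G -> 'I_n.+1} :=
  [ffun v => if insub v is Some w then lift ord_max (c w) else ord_max].

Lemma extend_last_val c (w : vertex (hrestr U)) :
  extend_last c (val w) = lift ord_max (c w).
Proof. by rewrite ffunE valK. Qed.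

Lemma extend_last_out c v : v \notin U -> extend_last c v = ord_max.
Proof. by move=> vU; rewrite ffunE insubN. Qed.

Lemma extend_last_inj : injective extend_last.
Proof.
move=> c d cd; apply/ffunP => w; apply: (@lift_inj _ ord_max).
by rewrite -!extend_last_val cd.
Qed.

Lemma not_last_extend c : not_last (extend_last c) = U.
Proof.
apply/setP => v; rewrite inE; have [vU|vU] := boolP (v \in U).
  by rewrite (extend_last_val c (exist _ v vU)) eq_sym neq_lift.
by rewrite extend_last_out // eqxx.
Qed.

Lemma extend_last_surj (c : {ffun vertex G -> 'I_n.+1}) :
  not_last c = U -> exists c', c = extend_last c'.
Proof.
move=> cU.
(* A color other than [ord_max] is a lift; choosing a preimage at each vertex of [U] gives the
   coloring to extend. *)
have /fin_all_exists[c' c'P] (w : vertex (hrestr U)) :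
    exists j, c (val w) = lift ord_max j.
  have : val w \in not_last c by rewrite cU; exact: valP.
  by rewrite inE eq_sym => /unlift_some[j cj _]; exists j.
exists (finfun c'); apply/ffunP => v; have [vU|vU] := boolP (v \in U).
  by rewrite (extend_last_val _ (exist _ v vU)) ffunE -c'P.
by rewrite extend_last_out //; move: vU; rewrite -cU inE negbK => /eqP.
Qed.

Hypothesis noE : [forall e : edge G, ~~ (inc e \subset ~: U)].

(** An edge inside [U] sees the same colors up to the injection [lift ord_max]. By [noE] any other
    edge meets both [U] and its complement, hence carries the last color and another one. *)
Lemma extend_last_colorings c :
  (extend_last c \in colorings G 'I_n.+1) =
  (c \in colorings (hrestr U) 'I_n).
Proof.
apply/coloringsP/coloringsP => col => [[e eU]|e].
  have [u [v [ue ve uv]]] := col e.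
  have uU := subsetP eU u ue; have vU := subsetP eU v ve.
  exists (exist _ u uU), (exist _ v vU); rewrite !inE; split=> //.
  apply: contraNneq uv => uv.
  by rewrite (extend_last_val c (exist _ u uU)) uv
             (extend_last_val c (exist _ v vU)).
have [eU|/subsetPn[v ve vU]] := boolP (inc e \subset U).
  have [u [v]] := col (exist (fun e => is_true (inc e \subset U)) e eU).
  rewrite !inE => -[ue ve uv]; exists (val u), (val v); split => //.
  by rewrite !extend_last_val (inj_eq (@lift_inj _ _)).
have /subsetPn[u ue] := forallP noE e; rewrite inE negbK => uU.
exists u, v; split=> //.
by rewrite (extend_last_val c (exist _ u uU)) extend_last_out // eq_sym neq_lift.
Qed.

Lemma card_colorings_not_last :
  #|[set c in colorings G 'I_n.+1 | not_last c == U]| =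
  #|colorings (hrestr U) 'I_n|.
Proof.
rewrite -(card_imset _ extend_last_inj); apply: eq_card => c; rewrite inE.
apply/andP/imsetP => [[col /eqP/extend_last_surj[c' cE]]|[c' col ->]].
  by exists c' => //; rewrite -extend_last_colorings -cE.
by rewrite extend_last_colorings not_last_extend.
Qed.

End LastColor.

Lemma coloring_no_edge_last (G : hypergraph) n (c : {ffun vertex G -> 'I_n.+1}) :
  c \in colorings G 'I_n.+1 ->
  [forall e : edge G, ~~ (inc e \subset ~: not_last c)].
Proof.
move=> /coloringsP col; apply/forallP => e; have [u [v [ue ve uv]]] := col e.
apply: contraNN uv => /subsetP sub.
by have := sub _ ue; have := sub _ ve; rewrite !inE !negbK => /eqP-> /eqP->.
Qed.

(** Colorings are sorted by the set [U] of vertices that avoid the last color. *)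
Lemma card_coloringsS (G : hypergraph) n :
  #|colorings G 'I_n.+1| =
  (\sum_(U : {set vertex G})
     #|colorings (hrestr U) 'I_n| * (#|edge (hrestr (~: U))| == 0))%N.
Proof.
rewrite -sum1_card (partition_big (@not_last G n) xpredT) //=.
apply: eq_bigr => U _; rewrite sum1dep_card card_edge_hrestr_eq0.
have [noE|E] := boolP [forall e : edge G, ~~ (inc e \subset ~: U)].
  by rewrite muln1 -card_colorings_not_last //; apply: eq_card => c; rewrite !inE.
(* Here some edge lies in [~: U]; it would be monochromatic in the last color, so the fiber over [U]
   is empty. *)
rewrite muln0; apply: eq_card0 => c; rewrite inE; apply/andP => -[col /eqP cU].
by move: E; rewrite -cU coloring_no_edge_last.
Qed.

(** The outer variable stands for the left tensor factor, so [.[a%:P].[b]] is evaluation at [a]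
    tensored with evaluation at [b]. *)
Lemma horner_XaY (p : {poly rat}) a b :
  (poly_XaY p).[a%:P].[b] = p.[a + b].
Proof. by rewrite horner_poly_XaY horner_comp !hornerE addrC. Qed.

Lemma horner_ptensor (p q : {poly rat}) a b :
  (ptensor p q).[a%:P].[b] = p.[a] * q.[b].
Proof. by rewrite /ptensor hornerM horner_map /= !hornerE. Qed.

Lemma tensor2U (chi : Hcirc -> {poly rat}) c d :
  tensor2 chi << (c, d) >> = ptensor (chi << c >>) (chi << d >>).
Proof. by rewrite /tensor2 mmapU mul1r. Qed.

Lemma tensor2_sum (chi : Hcirc -> {poly rat}) (I : finType) (a : I -> Hcirc2) :
  tensor2 chi (\sum_i a i) = \sum_i tensor2 chi (a i).
Proof. exact: raddf_sum. Qed.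

(** Evaluating the compatibility with [Delta] at [(a, b)] gives a binomial-type identity. *)
Lemma chi_addition (chi : {lrmorphism Hcirc -> {poly rat}}) (G : hypergraph)
    (a b : rat) : double_bialgebra_morphism chi ->
  (chi << class G >>).[a + b] =
  \sum_(U : {set vertex G}) (chi << class (hrestr U) >>).[a] *
                            (chi << class (hrestr (~: U)) >>).[b].
Proof.
move=> chi_morph.
apply: etrans (esym (horner_XaY _ _ _)) _.
rewrite (dbm_Delta chi_morph) Delta_class.
rewrite tensor2_sum !horner_sum; apply: eq_bigr => U _.
by rewrite tensor2U horner_ptensor.
Qed.

Theorem theorem6p4 (chi : {lrmorphism Hcirc -> {poly rat}})
    (chi_morph : double_bialgebra_morphism chi) (G : hypergraph) (n : nat) :
  (chi << class G >>).[n%:R] = #|colorings G 'I_n|%:R.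
Proof.
(* [G] stays general because the induction hypothesis is applied to each [hrestr U]. *)
elim: n G => [|n IHn] G.
  by rewrite (dbm_epsDelta chi_morph) epsDelta_class /epsDeltaG card_colorings0.
rewrite -natr1 (chi_addition _ _ _ chi_morph) card_coloringsS natr_sum.
apply: eq_bigr => U _; rewrite natrM; congr (_ * _); first exact: IHn.
by rewrite (dbm_epsdelta chi_morph) epsdelta_class.
Qed.
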